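(* Let $a,b,c,d\in\mathbb{R}$ with $ad-bc=1$, $a+d=\pm 2$ and $c\neq 0$, and let $g(x)=\frac{ax+b}{cx+d}$ be the corresponding real parabolic Möbius map on $\hat{\mathbb{R}}=\mathbb{R}\cup\{\infty\}$. Then the difference equation $b_{n+1}=g(b_n)$, $n\in\mathbb{N}_0$, has no Hyers-Ulam stability (on the real line), for any initial point $b_0\in\mathbb{R}$ and any given $\varepsilon>0$. Explicitly: there exists $\delta>0$ such that for every $\varepsilon>0$ there is a sequence $\{a_n\}_{n\in\mathbb{N}_0}$ in $\mathbb{R}$ with $g(a_n)\neq\infty$ and $|a_{n+1}-g(a_n)|\le\varepsilon$ for all $n\in\mathbb{N}_0$ such that, for every $b_0\in\mathbb{R}$, the sequence defined by $b_{n+1}=g(b_n)$ ($n\in\mathbb{N}_0$) satisfies $|a_n-b_n|>\delta$ for some $n\in\mathbb{N}$.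
   Context: $\mathbb{N}=\{1,2,\dots\}$, $\mathbb{N}_0=\mathbb{N}\cup\{0\}$, $g(\infty)=a/c$ and $g(-d/c)=\infty$. The solution $\{b_n\}$ is computed in $\hat{\mathbb{R}}$, and $|a_n-b_n|$ is understood to be $+\infty$ if $b_n=\infty$. Hyers-Ulam stability: the difference equation $b_{n+1}=g(b_n)$ has Hyers-Ulam stability if there is $K(\varepsilon)$ with $K(\varepsilon)\to 0$ as $\varepsilon\to 0$ such that for every $\varepsilon>0$ and every real sequence $\{a_n\}_{n\in\mathbb{N}_0}$ with $|a_{n+1}-g(a_n)|\le\varepsilon$ for all $n\in\mathbb{N}_0$ (with $a_n$ such that $g(a_n)\neq\infty$) there is a sequence $\{b_n\}_{n\in\mathbb{N}_0}$ with $b_{n+1}=g(b_n)$ for all $n\in\mathbb{N}_0$ and $|a_n-b_n|\le K(\varepsilon)$ for all $n\in\mathbb{N}$. Since any $\{a_n\}$ admissible for $\varepsilon$ is admissible for every larger $\varepsilon$, the failure of this property is equivalent to the explicit form in the claim. *)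

(* Defs.v *)
From mathcomp Require Import all_boot all_order all_algebra.
From mathcomp Require Import all_classical all_reals all_analysis.

Set Implicit Arguments.
Unset Strict Implicit.
Unset Printing Implicit Defensive.

Import Order.TTheory GRing.Theory Num.Theory.
Import numFieldNormedType.Exports.

Local Open Scope classical_set_scope.
Local Open Scope ring_scope.

(* The extended real line R u {oo} with a single point at infinity: [Some x]
   is the real number [x] and [None] is the point oo. *)
Notation ext_line R := (one_point_compactification R).

Definition moebius (R : realType) (a b c d : R) (z : ext_line R) : ext_line R :=
  match z with
  | Some x =>
      if c * x + d == 0 then None else Some ((a * x + b) / (c * x + d))
  | None => if c == 0 then None else Some (a / c)
  end.

(* |x - z| for x real and z in the extended line, equal to +oo when z = oo. *)
Definition ext_dist (R : realType) (x : R) (z : ext_line R) : \bar R :=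
  match z with
  | Some y => (`|x - y|)%:E
  | None => +oo%E
  end.

Definition solution (R : realType) (g : ext_line R -> ext_line R)
    (b : nat -> ext_line R) : Prop :=
  forall n : nat, b n.+1 = g (b n).

Definition approx_solution (R : realType) (g : ext_line R -> ext_line R)
    (e : R) (a : nat -> R) : Prop :=
  forall n : nat,
    g (Some (a n)) <> None /\ (ext_dist (a n.+1) (g (Some (a n))) <= e%:E)%E.

(* Hyers-Ulam stability on the real line: the exact solution starts at a real
   point but is computed in the extended line, and the two sequences are
   compared at the indices n >= 1 only. *)
Definition hyers_ulam_stable (R : realType) (g : ext_line R -> ext_line R)
    : Prop :=
  exists2 K : R -> R, K x @[x --> 0^'+] --> (0 : R) &
    forall (e : R) (a : nat -> R), 0 < e -> approx_solution g e a ->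
      exists (b0 : R) (b : nat -> ext_line R),
        [/\ b 0%N = Some b0, solution g b &
            forall n : nat, (0 < n)%N -> (ext_dist (a n) (b n) <= (K e)%:E)%E].

(* Main.v *)
Require Import Defs.
From mathcomp Require Import all_boot all_order all_algebra.
From mathcomp Require Import all_classical all_reals all_analysis.
From mathcomp Require Import ring lra zify.

Import Order.TTheory GRing.Theory Num.Theory.
Import numFieldNormedType.Exports.

Local Open Scope classical_set_scope.
Local Open Scope ring_scope.

(** A parabolic map has a single fixed point [p], and in the coordinate
    [w = 1 / (x - p)] it is a translation [w |-> w + t] with [t <> 0]
    ([moebius_chart]).  Two facts about translations give the theorem.

    Every exact orbit converges to [p], because its coordinate [w0 + n t] tends
    to infinity, or because the orbit is constantly [p]
    ([solution_near_fixed]).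

    An approximate orbit need not converge.  Far out in the [w]-line, both ends
    correspond to points close to [p]: a point that is just about to be absorbed
    by [p] on one side may jump, at a small cost in [x], to the other side of
    [p], from where the translation drives it away again.  The coordinate then
    runs periodically over the half-integer multiples
    [-(N + 1/2) t, ..., (N + 1/2) t] ([loop_coord], [loop_approx]); half-integers
    avoid [w = 0], the point at infinity.  Once per period the orbit visits
    [w = t / 2], at distance [2 / |t|] from [p], however small the permitted
    error is.  Hence no exact orbit stays within [1 / |t|] of it
    ([loop_far]). *)

(** * The coordinate in which a parabolic map is a translation *)

(** Inverse of the coordinate [x |-> 1 / (x - p)]: it covers every point of the
    extended line except [p]. *)
Definition chart {R : realType} (p w : R) : ext_line R :=
  if w == 0 then None else Some (p + w^-1).

Lemma chart_neq0 (R : realType) (p w : R) : w != 0 ->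
  chart p w = Some (p + w^-1).
Proof. by rewrite /chart => /negPf ->. Qed.

Lemma some_chart (R : realType) (p x : R) : x != p ->
  Some x = chart p (x - p)^-1.
Proof.
move=> xp; rewrite chart_neq0 ?invr_eq0 ?subr_eq0// invrK.
by rewrite addrC subrK.
Qed.

Lemma moebius_fixed (R : realType) (a b c d s : R) :
  a * d - b * c = 1 -> a + d = 2 * s -> s ^+ 2 = 1 -> c != 0 ->
  moebius a b c d (Some ((a - d) / (2 * c))) = Some ((a - d) / (2 * c)).
Proof.
move=> hdet htr hs c0 /=.
have s0 : s != 0 by rewrite -sqrf_eq0 hs oner_eq0.
have dE : d = 2 * s - a by rewrite -htr addrC addKr.
have bE : b = (a * d - s ^+ 2) / c by rewrite hs -hdet; field.
have -> : c * ((a - d) / (2 * c)) + d = s by rewrite dE; field.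
rewrite (negPf s0) bE dE; congr Some; field.
by rewrite c0 s0.
Qed.

(** Writing [s] for half the trace, [c x + d = s (w + s c) / w]: the pole is at
    [w = - s c], and the translation length is [s c]. *)
Lemma moebius_chart (R : realType) (a b c d s w : R) :
  a * d - b * c = 1 -> a + d = 2 * s -> s ^+ 2 = 1 -> c != 0 ->
  moebius a b c d (chart ((a - d) / (2 * c)) w)
    = chart ((a - d) / (2 * c)) (w + s * c).
Proof.
move=> hdet htr hs c0.
have s0 : s != 0 by rewrite -sqrf_eq0 hs oner_eq0.
have sV : s^-1 = s by rewrite -[LHS]mul1r -hs expr2 mulfK.
have dE : d = 2 * s - a by rewrite -htr addrC addKr.
have bE : b = (a * d - s ^+ 2) / c by rewrite hs -hdet; field.
have sE : s * (w + s * c) = s * w + c.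
  by rewrite mulrDr mulrA -expr2 hs mul1r.
have [->|w0] := eqVneq w 0.
  rewrite add0r [RHS]chart_neq0 ?mulf_neq0// /chart eqxx /= (negPf c0).
  by rewrite [(s * c)^-1]invfM sV dE; congr Some; field.
rewrite (chart_neq0 _ _ _ w0) /=.
have -> : c * ((a - d) / (2 * c) + w^-1) + d = s * (w + s * c) / w.
  by rewrite sE dE; field; rewrite c0 w0.
rewrite !mulf_eq0 invr_eq0 (negPf s0) (negPf w0) orbF /= /chart.
case: eqVneq => [//|wt0]; congr Some.
have -> : a * ((a - d) / (2 * c) + w^-1) + b
        = (a - d) / (2 * c) * (s * (w + s * c) / w) + s / w.
  by rewrite sE bE dE; field; rewrite c0 w0.
by field; rewrite c0 w0 s0 wt0.
Qed.

(** * Exact orbits *)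

Lemma solution_chart (R : realType) (g : ext_line R -> ext_line R)
    (p t w : R) (v : nat -> ext_line R) :
  (forall z, g (chart p z) = chart p (z + t)) ->
  solution g v -> v 0%N = chart p w ->
  forall n, v n = chart p (w + n%:R * t).
Proof.
move=> gE sv v0; elim=> [|n IH]; first by rewrite mul0r addr0.
by rewrite sv IH gE -addrA -[in RHS]natr1 mulrDl mul1r.
Qed.

(** An orbit starting at [b0 != p] has coordinate [w + n t] at time [n], where
    [w = 1 / (b0 - p)]; its distance to [p] is then [1 / |w + n t|], which is
    below [1 / |t|] as soon as [n > |w / t| + 1]. *)
Lemma solution_near_fixed (R : realType) (g : ext_line R -> ext_line R)
    (p t b0 : R) (v : nat -> ext_line R) :
  t != 0 -> g (Some p) = Some p ->
  (forall w, g (chart p w) = chart p (w + t)) ->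
  solution g v -> v 0%N = Some b0 ->
  exists M : nat, forall n, (M <= n)%N ->
    exists2 y : R, v n = Some y & `|y - p| < `|t|^-1.
Proof.
move=> t0 gp gE sv v0.
have tgt0 : 0 < `|t| by rewrite normr_gt0.
have [b0p|b0p] := eqVneq b0 p.
  exists 0%N => n _; exists p; last by rewrite subrr normr0 invr_gt0.
  by elim: n => [|n IH]; rewrite ?v0 ?b0p// sv IH gp.
set w := (b0 - p)^-1.
have vE := solution_chart _ _ _ _ w _ gE sv (etrans v0 (some_chart _ _ _ b0p)).
have wE : w = (w / t) * t by rewrite divfK.
exists (Num.truncn `|w / t|).+2 => n Mn.
have q_lt : `|w / t| + 1 < n%:R.
  apply: (@lt_le_trans _ _ (Num.truncn `|w / t|).+2%:R); last by rewrite ler_nat.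
  by rewrite -[X in _ < X]natr1 ltrD2r truncnS_gt.
have far : `|t| < `|w + n%:R * t|.
  rewrite {1}wE -mulrDl normrM ltr_pMl//.
  by move: (ler_norm (w / t + n%:R)) (ler_norm (- (w / t))); rewrite normrN; lra.
have wn0 : w + n%:R * t != 0 by rewrite -normr_gt0 (lt_trans tgt0).
exists (p + (w + n%:R * t)^-1); first by rewrite vE chart_neq0.
by rewrite addrC addKr normfV ltf_pV2 ?posrE// normr_gt0.
Qed.

(** * Approximate orbits that keep returning *)

(** The coordinate of the periodic approximate orbit: it sweeps the [2 N + 2]
    half-integer multiples of [t] in [[- (N + 1/2) t, (N + 1/2) t]] and then
    starts again. *)
Definition loop_coord {R : realType} (t : R) (N n : nat) : R :=
  ((n %% (N.+1).*2)%:R - N%:R - 2^-1) * t.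

Lemma half_int_neq0 (R : realType) (m N : nat) : m%:R - N%:R - 2^-1 != 0 :> R.
Proof.
apply/eqP => h.
have : (m.*2)%:R = (N.*2.+1)%:R :> R.
  by rewrite -addn1 natrD -!mul2n !natrM; lra.
by move/eqP; rewrite eqr_nat => /eqP; lia.
Qed.

Lemma loop_coord_neq0 (R : realType) (t : R) N n : t != 0 ->
  loop_coord t N n != 0.
Proof. by move=> t0; rewrite mulf_neq0// half_int_neq0. Qed.

Lemma loop_coord_step_neq0 (R : realType) (t : R) N n : t != 0 ->
  loop_coord t N n + t != 0.
Proof.
move=> t0; rewrite -[X in _ + X]mul1r -mulrDl mulf_neq0//.
by rewrite addrAC (addrAC _ _ 1) natr1 half_int_neq0.
Qed.

Lemma loop_coord_half (R : realType) (t : R) N j :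
  loop_coord t N (j * (N.+1).*2 + N.+1) = t / 2.
Proof.
rewrite /loop_coord modnMDl modn_small; last by lia.
by rewrite -natr1; field.
Qed.

(** The translation is followed exactly except at the end of a period. *)
Lemma loop_coordS (R : realType) (t : R) N n :
  loop_coord t N n.+1 = loop_coord t N n + t \/
  loop_coord t N n = (N%:R + 2^-1) * t /\
    loop_coord t N n.+1 = - ((N%:R + 2^-1) * t).
Proof.
rewrite /loop_coord; set q := (N.+1).*2.
have [last_step|not_last] := eqVneq (n %% q).+1 q.
  right.
  have -> : (n.+1 %% q = 0)%N by rewrite -addn1 -modnDml addn1 last_step modnn.
  have -> : (n %% q = N + N.+1)%N by move: last_step; rewrite /q; lia.
  by rewrite natrD -natr1; split; field.
left.
have lt_q : (n %% q < q)%N by rewrite ltn_mod.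
have -> : (n.+1 %% q = (n %% q).+1)%N.
  by rewrite -addn1 -modnDml addn1 modn_small// ltn_neqAle not_last.
by rewrite -natr1; ring.
Qed.

(** At the jump from [(N + 3/2) t] to [- (N + 1/2) t] both points are within
    [1 / ((N + 1/2) |t|)] of [p], on opposite sides. *)
Lemma loop_approx (R : realType) (g : ext_line R -> ext_line R)
    (p t e : R) (N : nat) :
  t != 0 -> (forall w, g (chart p w) = chart p (w + t)) ->
  0 < e -> 2 / (e * `|t|) <= N%:R ->
  approx_solution g e (fun n => p + (loop_coord t N n)^-1).
Proof.
move=> t0 gE e0 HN n; have tgt0 : 0 < `|t| by rewrite normr_gt0.
rewrite -chart_neq0 ?loop_coord_neq0// gE chart_neq0 ?loop_coord_step_neq0//.
split=> //; rewrite /= lee_fin opprD addrACA subrr add0r.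
have [->|[-> ->]] := loop_coordS _ t N n; first by rewrite subrr normr0 ltW.
set h : R := N%:R + 2^-1.
have N0 : 0 <= N%:R :> R by rewrite ler0n.
have h0 : 0 < h by rewrite /h; lra.
have h1 : 0 < h + 1 by lra.
have -> : (- (h * t))^-1 - (h * t + t)^-1 = - ((h^-1 + (h + 1)^-1) / t).
  rewrite -[X in h * t + X]mul1r -mulrDl; field.
  by rewrite t0 !gt_eqF.
have hV : (h + 1)^-1 <= h^-1 by rewrite lef_pV2 ?posrE; lra.
have hV0 : 0 < (h + 1)^-1 by rewrite invr_gt0.
rewrite normrN normrM normfV ler_pdivrMr// ger0_norm; last by lra.
apply: (@le_trans _ _ (2 * h^-1)); first by lra.
rewrite ler_pdivrMr// mulrC -ler_pdivrMr ?mulr_gt0//.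
by rewrite /h; lra.
Qed.

Lemma loop_far (R : realType) (g : ext_line R -> ext_line R)
    (p t b0 : R) (N : nat) (v : nat -> ext_line R) :
  t != 0 -> g (Some p) = Some p ->
  (forall w, g (chart p w) = chart p (w + t)) ->
  v 0%N = Some b0 -> solution g v ->
  exists2 n : nat, (0 < n)%N &
    (`|t|^-1%:E < ext_dist (p + (loop_coord t N n)^-1) (v n))%E.
Proof.
move=> t0 gp gE v0 sv.
have [M near] := solution_near_fixed _ _ _ _ _ _ t0 gp gE sv v0.
exists (M * (N.+1).*2 + N.+1)%N; first by lia.
have [|y -> yp] := near (M * (N.+1).*2 + N.+1)%N; first by nia.
rewrite loop_coord_half /ext_dist lte_fin invf_div.
have far : `|2 / t| = 2 * `|t|^-1 by rewrite normrM normfV ger0_norm.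
have tri : `|2 / t| <= `|p + 2 / t - y| + `|y - p|.
  apply: le_trans (ler_normD _ _).
  by rewrite (_ : p + 2 / t - y + (y - p) = 2 / t)//; ring.
by lra.
Qed.

(** * From the explicit form to the failure of stability *)

(** A stability modulus tending to [0] is eventually below the fixed distance
    [delta], at an error for which the bad approximate orbit exists. *)
Lemma far_not_stable (R : realType) (g : ext_line R -> ext_line R) (delta : R) :
  0 < delta ->
  (forall e : R, 0 < e ->
    exists2 u : nat -> R, approx_solution g e u &
      forall (b0 : R) (v : nat -> ext_line R),
        v 0%N = Some b0 -> solution g v ->
        exists2 n : nat, (0 < n)%N & (delta%:E < ext_dist (u n) (v n))%E) ->
  ~ hyers_ulam_stable g.
Proof.
move=> delta0 bad [K K0 stab].
have [e [e0 Ke]] : exists e : R, 0 < e /\ K e < delta.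
  have ev : \forall e \near (0 : R)^'+, 0 < e /\ K e < delta.
    near=> e; split; first by near: e; exact: nbhs_right_gt.
    by near: e; exact: (cvgr_lt _ K0).
  exact: (@filter_ex _ (0 : R)^'+ _ _ ev).
have [u au far] := bad e e0.
have [b0 [v [v0 sv close]]] := stab e u e0 au.
have [n n0 gap] := far b0 v v0 sv.
have := lt_le_trans gap (close n n0).
by rewrite lte_fin => /(lt_trans Ke); rewrite ltxx.
Unshelve. all: by end_near.
Qed.

Theorem theorem6p1 (R : realType) (a b c d : R)
    (hdet : a * d - b * c = 1)
    (htr : a + d = 2 \/ a + d = - 2)
    (hc : c <> 0) :
  ~ hyers_ulam_stable (moebius a b c d) /\
  exists2 delta : R, 0 < delta &
    forall e : R, 0 < e ->
      exists2 u : nat -> R, approx_solution (moebius a b c d) e u &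
        forall (b0 : R) (v : nat -> ext_line R),
          v 0%N = Some b0 -> solution (moebius a b c d) v ->
          exists2 n : nat, (0 < n)%N & (delta%:E < ext_dist (u n) (v n))%E.
Proof.
have c0 : c != 0 by apply/eqP.
have [s htr' hs] : exists2 s : R, a + d = 2 * s & s ^+ 2 = 1.
  by case: htr => ->; [exists 1 | exists (- 1)];
    rewrite ?mulr1 ?mulrN1 ?sqrrN ?expr1n.
have t0 : s * c != 0 by rewrite mulf_neq0// -sqrf_eq0 hs oner_eq0.
have gp := moebius_fixed _ _ _ _ _ _ hdet htr' hs c0.
have gE w := moebius_chart _ _ _ _ _ _ w hdet htr' hs c0.
have delta0 : 0 < `|s * c|^-1 by rewrite invr_gt0 normr_gt0.
suff far : forall e : R, 0 < e ->
    exists2 u : nat -> R, approx_solution (moebius a b c d) e u &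
      forall (b0 : R) (v : nat -> ext_line R),
        v 0%N = Some b0 -> solution (moebius a b c d) v ->
        exists2 n : nat, (0 < n)%N & (`|s * c|^-1%:E < ext_dist (u n) (v n))%E.
  by split; [exact: far_not_stable delta0 far | exists `|s * c|^-1].
move=> e e0; set N := (Num.truncn (2 / (e * `|s * c|))).+1.
exists (fun n => (a - d) / (2 * c) + (loop_coord (s * c) N n)^-1).
  by apply: loop_approx => //; rewrite ltW// truncnS_gt.
by move=> b0 v; exact: loop_far.
Qed.
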